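(* Let $G=(V,E)$ be a finite graph (loops and multiple edges allowed) and let $A,B\subseteq V^2$. For $S\subseteq E$, let $\mathrm{Four}_{G,S}(A,B)$ denote the set of $(A,B)$-valid fourientations of $G$ whose set of solid edges is exactly $S$. Then the cardinality $|\mathrm{Four}_{G,S}(A,B)|$ does not depend on $S\subseteq E$.
   Context: A fourientation $\phi$ of $G$ assigns to each edge one of four configurations: 0-way (the edge cannot be traversed), 2-way (it can be traversed in both directions), or one of two 1-way configurations (it can be traversed in exactly one specified direction); loops also have these four configurations. The associated digraph $\vec\phi$ on vertex set $V$ has, for each 2-way edge, two arcs in opposite directions between its endpoints, for each 1-way edge the single arc in its allowed direction, and no arc for 0-way edges. An edge is solid if it is 0-way or 2-way. Given $A,B\subseteq V^2$, $\vec G(A,B;\phi)$ denotes the digraph obtained from $\vec\phi$ by adding an arc from $u$ to $v$ for every pair $(u,v)\in A$ and for every pair $(u,v)\in B$. The fourientation $\phi$ is $(A,B)$-valid if in $\vec G(A,B;\phi)$: (a) for every $(u,v)\in A$, there is no directed path from $v$ to $u$; and (b) for every $(u,v)\in B$, there is a directed path from $v$ to $u$. *)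

(* Defs.v *)
From mathcomp Require Import all_boot.

Set Implicit Arguments.
Unset Strict Implicit.
Unset Printing Implicit Defensive.

(* An undirected finite graph, loops and parallel edges allowed.  The order in
   which the two ends of an edge are listed is an arbitrary reference
   orientation: it only serves to name the two directions of traversal, which
   stay distinct for a loop. *)
Record multigraph (V E : finType) := Multigraph {
  src : E -> V;
  tgt : E -> V
}.

Section Fourientations.

Variables (V E : finType) (G : multigraph V E).

(* phi e = (f, b): e can be traversed from src e to tgt e iff f, and from tgt e
   to src e iff b.  Hence (false, false) is 0-way, (true, true) is 2-way and
   the other two values are the 1-way configurations. *)
Definition fourientation := {ffun E -> bool * bool}.

Implicit Types (phi : fourientation) (A B : {set V * V}) (S : {set E}).

Definition zero_way phi (e : E) : bool := phi e == (false, false).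
Definition two_way phi (e : E) : bool := phi e == (true, true).

Definition solid_edges phi : {set E} :=
  [set e | zero_way phi e || two_way phi e].

(* Only directed paths matter below, so digraphs are taken up to multiplicity
   of arcs. *)
Definition arc phi : rel V := fun u v =>
  [exists e : E, [&& (phi e).1, src G e == u & tgt G e == v]
              || [&& (phi e).2, tgt G e == u & src G e == v]].

Definition arcAB A B phi : rel V := fun u v =>
  [|| arc phi u v, (u, v) \in A | (u, v) \in B].

(* [connect] admits the empty path from u to u; this is harmless for validity,
   since a pair (u, u) in A or B contributes a loop arc at u anyway. *)
Definition valid A B phi : bool :=
  [forall p in A, ~~ connect (arcAB A B phi) p.2 p.1] &&
  [forall p in B, connect (arcAB A B phi) p.2 p.1].

Definition Four S A B : {set fourientation} :=
  [set phi | valid A B phi & solid_edges phi == S].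

End Fourientations.

(* Main.v *)
(** Fix an edge e with ends x, y and the configuration of all other edges.  If
    traversing e from x to y puts on a directed cycle some arc p of A or B which
    was on none before, then no arc q of A or B lies on a path from x to y
    avoiding e, for otherwise this path would close up a cycle through p without
    e.  Hence validity does not depend on one of the two directions of e, and
    flipping that direction is an involution which preserves validity and
    changes the solidity of e only. *)

Require Import Defs.
From mathcomp Require Import all_boot.

Set Implicit Arguments.
Unset Strict Implicit.
Unset Printing Implicit Defensive.

(** The flag [f] tells whether the arc is present, so that a single formula covers all four
    configurations of an edge. *)
Definition add_arc (T : eqType) (f : bool) (x y : T) (R : rel T) : rel T :=
  fun u v => R u v || [&& f, x == u & y == v].

(** One use of the new arc is enough: in a path that uses it, keep the part before the first use and
    the part after the last one. *)
Lemma connect_add_arc (T : finType) f (x y : T) (R : rel T) u v :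
  connect (add_arc f x y R) u v
  = connect R u v || [&& f, connect R u x & connect R y v].
Proof.
have sub a b : connect R a b -> connect (add_arc f x y R) a b.
  by apply: connect_sub => c d Rcd; apply: connect1; rewrite /add_arc Rcd.
apply/idP/idP => [/connectP[p] | ].
  elim: p u => [|w p IHp] u /= => [_ ->|/andP[uw wp] vE].
    by rewrite connect0.
  have {IHp} /orP[wv|/and3P[f1 wx yv]] := IHp w wp vE.
    case/orP: uw => [Ruw|/and3P[f1 /eqP xu /eqP yw]].
      by rewrite (connect_trans (connect1 Ruw) wv).
    by rewrite f1 -xu yw wv connect0 orbT.
  case/orP: uw => [Ruw|/and3P[_ /eqP xu /eqP yw]].
    by rewrite f1 yv (connect_trans (connect1 Ruw) wx) orbT.
  by rewrite f1 yv -xu connect0 orbT.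
case/orP => [/sub //|/and3P[f1 /sub ux /sub yv]].
apply: connect_trans ux (connect_trans (connect1 _) yv).
by rewrite /add_arc f1 !eqxx orbT.
Qed.

Section FlipEdge.

Variables (V E : finType) (G : multigraph V E) (A B : {set V * V}) (e : E).

Implicit Types (phi : fourientation E) (S : {set E}).

Let x := src G e.
Let y := tgt G e.

Definition set_edge phi (c : bool * bool) : fourientation E :=
  [ffun i => if i == e then c else phi i].

Lemma set_edge_set phi c d : set_edge (set_edge phi c) d = set_edge phi d.
Proof. by apply/ffunP => i; rewrite !ffunE; case: eqP. Qed.

Lemma set_edge_id phi : set_edge phi (phi e) = phi.
Proof. by apply/ffunP => i; rewrite !ffunE; case: eqP => // ->. Qed.

Lemma arcAB_set_edge phi f b :
  arcAB G A B (set_edge phi (f, b))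
  =2 add_arc b y x (add_arc f x y
       (arcAB G A B (set_edge phi (false, false)))).
Proof.
move=> u v; rewrite /add_arc /arcAB -!orbA.
set r := (_ \in A); set s := (_ \in B).
suff -> : Defs.arc G (set_edge phi (f, b)) u v
    = [|| Defs.arc G (set_edge phi (false, false)) u v,
          [&& f, x == u & y == v] | [&& b, y == u & x == v]].
  by case: r; case: s; rewrite ?orbT ?orbF.
apply/existsP/or3P => [[i]|[/existsP[i]|fP|bP]].
- rewrite ffunE; case: eqP => [->|/eqP/negPf ie] /=.
    by case/orP; [constructor 2 | constructor 3].
  by move=> iP; constructor 1; apply/existsP; exists i; rewrite ffunE ie.
- rewrite ffunE; case: eqP => [//|/eqP/negPf ie] iP.
  by exists i; rewrite ffunE ie.
- by exists e; rewrite ffunE eqxx /= fP.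
- by exists e; rewrite ffunE eqxx /= bP orbT.
Qed.

Lemma eq_valid phi psi :
  {in A :|: B, forall p, connect (arcAB G A B phi) p.2 p.1
                       = connect (arcAB G A B psi) p.2 p.1} ->
  valid G A B phi = valid G A B psi.
Proof.
move=> eq_c; rewrite /valid; congr (_ && _); apply: eq_forallb => p.
  by case pA: (p \in A) => //=; rewrite eq_c // inE pA.
by case pB: (p \in B) => //=; rewrite eq_c // inE pB orbT.
Qed.

Lemma valid_direction_free phi :
  (forall f b, valid G A B (set_edge phi (f, b))
             = valid G A B (set_edge phi (false, b)))
  \/ (forall f b, valid G A B (set_edge phi (f, b))
                = valid G A B (set_edge phi (f, false))).
Proof.
set R := arcAB G A B (set_edge phi (false, false)).
(* For [p] in [A] or [B], [F p] says that some closed walk through [p] crosses [e] exactly once,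
   from [x] to [y]; [W p] is the same for the other direction. *)
pose F (p : V * V) := connect R p.2 x && connect R y p.1.
pose W (p : V * V) := connect R p.2 y && connect R x p.1.
have ABR p : p \in A :|: B -> connect R p.1 p.2.
  case: p => a b; rewrite inE => ABp; apply: connect1.
  by rewrite /R /arcAB; case/orP: ABp => ->; rewrite !orbT.
have reachE f b p : connect (arcAB G A B (set_edge phi (f, b))) p.2 p.1
    = [|| connect R p.2 p.1, f && F p | b && W p].
  rewrite (eq_connect (arcAB_set_edge phi f b)) !connect_add_arc -/R /F /W.
  rewrite !connect0 !andbT.
  (* If both directions of [e] are open, mixed terms arise, in which a walk reaches an end of [e]
     and leaves from that same end. By transitivity they already give a path in [R]. *)
  case: f; case: b => //=; rewrite ?orbF -?orbA //.
  have tr := @connect_trans _ R.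
  case Cp: (connect R p.2 p.1) => //=.
  have nx : connect R p.2 x -> connect R x p.1 = false.
    by move=> h1; apply/negP => /(tr _ _ _ h1); rewrite Cp.
  have ny : connect R p.2 y -> connect R y p.1 = false.
    by move=> h1; apply/negP => /(tr _ _ _ h1); rewrite Cp.
  move: nx ny; case: (connect R p.2 x); case: (connect R p.2 y) => //= nx ny.
  - by rewrite nx // ny.
  - by rewrite nx // ?orbF ?orbb.
  - by rewrite ny // ?orbF.
case: (boolP [exists p in A :|: B, F p && ~~ connect R p.2 p.1]).
  case/exists_inP => p pAB /andP[/andP[px yp] /negP Np].
  right=> f b; apply: eq_valid => q qAB; rewrite (reachE f b) (reachE f false).
  case: (boolP (W q)) => [/andP[qy xq]|]; last by rewrite !andbF.
  (* The walk p.2, x, q.1, q.2, y, p.1 stays in [R], the arc [q] being itself in [R]. *)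
  case: Np; apply: connect_trans px (connect_trans xq _).
  exact: connect_trans (ABR _ qAB) (connect_trans qy yp).
move/exists_inPn => noF; left=> f b; apply: eq_valid => q /noF.
rewrite (reachE f b) (reachE false b).
by case: (F q) => /=; rewrite ?andbF // negbK => ->.
Qed.

(** Quantifying over all configurations of [e] makes this depend on the other edges only. A flip at
    [e] thus leaves the choice of direction unchanged, so flipping twice is the identity. *)
Definition forward_free phi : bool :=
  [forall f, forall b, valid G A B (set_edge phi (f, b))
                       == valid G A B (set_edge phi (false, b))].

Definition flip_edge phi : fourientation E :=
  set_edge phi (if forward_free phi then (~~ (phi e).1, (phi e).2)
                else ((phi e).1, ~~ (phi e).2)).

Lemma forward_free_set_edge phi c :
  forward_free (set_edge phi c) = forward_free phi.
Proof.
by apply: eq_forallb => f; apply: eq_forallb => b; rewrite !set_edge_set.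
Qed.

Lemma flip_edgeK : involutive flip_edge.
Proof.
move=> phi; rewrite {1}/flip_edge forward_free_set_edge set_edge_set.
rewrite /flip_edge ffunE eqxx -[RHS]set_edge_id.
by case: (forward_free phi); case: (phi e) => f b /=; rewrite negbK.
Qed.

Lemma valid_flip_edge phi : valid G A B (flip_edge phi) = valid G A B phi.
Proof.
rewrite -{2}(set_edge_id phi) /flip_edge; case: (phi e) => f b /=.
have [/forallP free|not_free] := boolP (forward_free phi).
  have freeE f' := eqP (forallP (free f') b).
  by rewrite freeE [RHS]freeE.
(* If the forward direction matters, the dichotomy leaves the backward one, which is the one
   flipped. *)
have [free|free] := valid_direction_free phi; last by rewrite free [RHS]free.
case/negP: not_free; apply/forallP => f'; apply/forallP => b'.
by apply/eqP; apply: free.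
Qed.

(** An edge is solid exactly when its two bits agree, so negating either bit toggles this. *)
Lemma solid_flip_edge phi i :
  (i \in solid_edges (flip_edge phi)) = (i == e) (+) (i \in solid_edges phi).
Proof.
rewrite !inE /zero_way /two_way ffunE; case: (i =P e) => [->|//].
by case: (forward_free phi); case: (phi e) => [[] []].
Qed.

(** The flip at [e] is a bijection between the two sets. *)
Lemma card_Four_setD1 S : e \in S -> #|Four G S A B| = #|Four G (S :\ e) A B|.
Proof.
move=> eS; rewrite -(card_preimset (Four G S A B) (inv_inj flip_edgeK)).
apply: eq_card => phi; rewrite !inE valid_flip_edge; congr (_ && _).
apply/eqP/eqP => defS; apply/setP => i.
  rewrite in_setD1 -defS solid_flip_edge; case: eqP => //= ->.
  by move: eS; rewrite -defS solid_flip_edge eqxx => /negPf.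
by rewrite solid_flip_edge defS !inE; case: eqP => [->|].
Qed.

End FlipEdge.

Theorem theorem3p1 (V E : finType) (G : multigraph V E) (A B : {set V * V})
  (S T : {set E}) : #|Four G S A B| = #|Four G T A B|.
Proof.
(* Solid edges are removed one at a time until none is left. *)
suff to_set0 n (U : {set E}) : #|U| = n -> #|Four G U A B| = #|Four G set0 A B|.
  by rewrite (to_set0 _ S erefl) (to_set0 _ T erefl).
elim: n U => [U /eqP|n IHn U cardU]; first by rewrite cards_eq0 => /eqP->.
have [e eU] : exists e, e \in U by apply/card_gt0P; rewrite cardU.
rewrite (card_Four_setD1 G A B eU) IHn //.
by move: cardU; rewrite (cardsD1 e) eU => -[].
Qed.
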